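(* Let $n\ge3$, $\beta=(\beta_1,\ldots,\beta_n)\in\{0,1\}^n$, $\sigma_i=(-1)^{\beta_i}$, $r=\beta_1+\cdots+\beta_n$, $\sigma=\sigma_1\cdots\sigma_n=(-1)^r$, and let $s\in\{0,1\}$ be such that $\sigma=(-1)^s$. Write $\mu^\beta_j=2\cos\frac{(2j+s)\pi}{n}$ for the eigenvalues of $A_\beta$; as given by this formula, $\mu^\beta_j=\mu^\beta_{n-s-j}$. For $j=0,1,\ldots,\lfloor n/2\rfloor$, two independent eigenvectors of $A_\beta$ associated to the eigenvalue $\mu^\beta_j$ are the vectors $x^\beta_j=(x^\beta_{jk})_{k=1}^n$ and $y^\beta_j=(y^\beta_{jk})_{k=1}^n$ given by $$x^\beta_{jk}=\sigma_1\cdots\sigma_k\cos\frac{(2j+s)k\pi}{n},\qquad y^\beta_{jk}=\sigma_1\cdots\sigma_k\sin\frac{(2j+s)k\pi}{n},$$ and the eigenspace associated to $\mu^\beta_j$ is the span of $x^\beta_j$ and $y^\beta_j$; with the following exceptions. (a) When $\sigma=+1$ ($r$ even, $s=0$), the eigenvectors of $A_\beta$ associated to the eigenvalue $\mu^\beta_0=2$ are the (nonzero) scalar multiples of the vector $x^\beta_0$ with components $x^\beta_{0k}=\sigma_1\cdots\sigma_k$, $k=1,\ldots,n$. (b) When $\sigma=+1$ and $n$ is even, $n=2m$, the eigenvectors of $A_\beta$ associated to the eigenvalue $\mu^\beta_m=-2$ are the (nonzero) scalar multiples of the vector $x^\beta_m$ with components $x^\beta_{mk}=(-1)^k\sigma_1\cdots\sigma_k$,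 $k=1,\ldots,n$. (c) When $\sigma=-1$ ($r$ odd, $s=1$) and $n$ is odd, $n=2m+1$, the eigenvectors of $A_\beta$ associated to the eigenvalue $\mu^\beta_m=-2$ are the (nonzero) scalar multiples of the vector $x^\beta_m$ with components $x^\beta_{mk}=(-1)^k\sigma_1\cdots\sigma_k$, $k=1,\ldots,n$.
   Context: Let $B$ be the $n\times n$ real matrix whose $(i,i+1)$ entries equal $1$ for $i=1,\ldots,n-1$, whose $(n,1)$ entry equals $1$, and whose other entries are $0$. For $\beta=(\beta_1,\ldots,\beta_n)\in\{0,1\}^n$ put $\sigma_i=(-1)^{\beta_i}$, and let $B_\beta$ be the matrix obtained from $B$ by multiplying the $i$th column by $\sigma_i$, for every $i=1,\ldots,n$. The matrix $B_\beta$ is orthogonal, so its transpose $B_\beta'$ equals $B_\beta^{-1}$. Put $A_\beta=B_\beta+B_\beta'=B_\beta+B_\beta^{-1}$. (This is the adjacency matrix of the cycle of length $n$ on vertices $v_1,\ldots,v_n$ in which the edge $e_i=v_{i-1}v_i$, with $v_0=v_n$, carries the sign $\sigma_i$.) Eigenvectors and eigenspaces are taken over $\mathbb R$. *)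

(* Defs.v *)
(* Vertices, columns and signs 1..n are indexed by 'I_n from 0: i : 'I_n stands
   for i.+1. *)
From mathcomp Require Import all_boot all_order all_algebra.
From mathcomp Require Import all_classical all_reals all_analysis.

Set Implicit Arguments.
Unset Strict Implicit.
Unset Printing Implicit Defensive.

Import Order.TTheory GRing.Theory Num.Theory.
Local Open Scope ring_scope.

Section SignedCycle.
Variables (R : realType) (n : nat).

Definition cycle_mx : 'M[R]_n :=
  \matrix_(i, j) (((j : nat) == i.+1) ||
                  ((i.+1 == n) && ((j : nat) == 0)))%N%:R.

Variable beta : 'I_n -> bool.

Definition edge_sign (i : 'I_n) : R := (-1) ^+ beta i.

Definition neg_count : nat := (\sum_(i < n) beta i)%N.

Definition cycle_sign : R := \prod_(i < n) edge_sign i.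

Definition sign_upto (k : 'I_n) : R := \prod_(i < n | (i <= k)%N) edge_sign i.

Definition signed_cycle_mx : 'M[R]_n :=
  \matrix_(i, j) (edge_sign j * cycle_mx i j).

Definition adj_mx : 'M[R]_n := signed_cycle_mx + signed_cycle_mx^T.

Variable s : bool.

Definition mu (j : int) : R := 2 * cos ((2 * j%:~R + s%:R) * pi / n%:R).

Definition xvec (j : int) : 'cV[R]_n :=
  \col_k (sign_upto k * cos ((2 * j%:~R + s%:R) * k.+1%:R * pi / n%:R)).

Definition yvec (j : int) : 'cV[R]_n :=
  \col_k (sign_upto k * sin ((2 * j%:~R + s%:R) * k.+1%:R * pi / n%:R)).

End SignedCycle.

Section Eigen.
Variables (F : fieldType) (n : nat).

(* Column-vector convention: eigenvalue and eigenspace of mxalgebra are about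
   row vectors, so we use those of the linear map v |-> A *m v. *)
Definition mx_fun (A : 'M[F]_n) : 'End('cV[F]_n) := linfun (mulmx A).

Definition eigenvector (A : 'M[F]_n) (a : F) (v : 'cV[F]_n) : Prop :=
  v != 0 /\ A *m v = a *: v.

Lemma leigenspace_mxP (A : 'M[F]_n) (a : F) (v : 'cV[F]_n) :
  reflect (A *m v = a *: v) (v \in passmx.leigenspace (mx_fun A) a).
Proof.
rewrite memv_ker add_lfunE opp_lfunE scale_lfunE id_lfunE lfunE /= subr_eq0.
exact: eqP.
Qed.

End Eigen.

(* Main.v *)
Require Import Defs.
From mathcomp Require Import all_boot all_order all_algebra.
From mathcomp Require Import all_classical all_reals all_analysis.
From mathcomp Require Import ring lra zify.
Import Order.TTheory GRing.Theory Num.Theory.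
Local Open Scope ring_scope.

(** Flipping the sign of the k-th coordinate by [sigma_1 ... sigma_k] removes all
signs from the signed cycle except for one global twist. Writing
[w_k = sigma_1 ... sigma_k v_k], the equation [A_beta v = a v] says that [w]
satisfies the three-term recurrence [w_k + w_(k+2) = a w_(k+1)], where [w] is
extended to all natural indices by [w_(k+n) = sigma w_k]; this is
[gauge_eigen], and [gauge_surj] says that every vector arises in this way. The
rest of the argument is about scalar sequences.

Spectrum. Looking at an index where [|w|] is maximal gives [|a| <= 2], so
[a = 2 cos t] with [0 <= t <= pi]. The recurrence then propagates to steps of
any length, [w_k + w_(k+2m) = 2 cos (m t) w_(k+m)] ([three_term_dilate]); for
[m = n] the twist turns this into [cos (n t) = sigma], so that
[n t = (2j+s) pi] for some [j], and [t <= pi] forces [j <= n/2]. Conversely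
[cos (k t)] and [sin (k t)] solve the recurrence, and they have the right twist
exactly because [n t] is a multiple of [pi] with the parity of [s].

Eigenspaces. A solution of the recurrence is determined by [w_0] and [w_1]. If
[sin t <> 0], then [cos (k t)] and [sin (k t)] realise all pairs of initial
values, so the eigenspace is the plane that they span. If [sin t = 0], a solution
with [w_0 = 0] is [w_k = k (cos t)^(k+1) w_1], which grows linearly; the twist
gives [w_n = sigma w_0 = 0], hence [w_1 = 0], and only the multiples of
[cos (k t)] survive. For the angles [(2j+s) pi / n] with [j <= n/2], the second
case happens precisely for the angles [0] and [pi], which are the three exceptions
of the theorem. *)

(** * Three-term recurrences with a twisted period *)

Definition three_term {R : pzRingType} (a : R) (w : nat -> R) : Prop :=
  forall k, w k + w k.+2 = a * w k.+1.

Definition quasiperiodic {R : pzRingType} (n : nat) (c : R)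
    (w : nat -> R) : Prop :=
  forall k, w (k + n)%N = c * w k.

Lemma three_term_comb {R : comPzRingType} {a : R} (c d : R) {u w : nat -> R} :
  three_term a u -> three_term a w ->
  three_term a (fun k => c * u k + d * w k).
Proof.
move=> hu hw k.
transitivity (c * (u k + u k.+2) + d * (w k + w k.+2)); first by ring.
by rewrite hu hw; ring.
Qed.

Lemma quasiperiodic_comb {R : comPzRingType} {n : nat} {b : R} (c d : R)
    {u w : nat -> R} :
  quasiperiodic n b u -> quasiperiodic n b w ->
  quasiperiodic n b (fun k => c * u k + d * w k).
Proof. by move=> hu hw k; rewrite hu hw; ring. Qed.

Lemma three_term_eq0 {R : pzRingType} {a : R} {w : nat -> R} :
  three_term a w -> w 0%N = 0 -> w 1%N = 0 -> forall k, w k = 0.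
Proof.
move=> hw w0 w1 k; suff [] : w k = 0 /\ w k.+1 = 0 by [].
elim: k => [|k [IH0 IH1]]; split=> //.
by have := hw k; rewrite IH0 IH1 add0r mulr0.
Qed.

Lemma quasiperiodic_modn {R : pzRingType} {n : nat} {c : R} {w : nat -> R} :
  quasiperiodic n c w -> forall k, w k = c ^+ (k %/ n) * w (k %% n)%N.
Proof.
move=> hw k; rewrite {1}(divn_eq k n) addnC.
elim: (k %/ n)%N => [|q IH]; first by rewrite mul0n addn0 mul1r.
by rewrite mulSn addnCA addnC hw IH exprS mulrA.
Qed.

Lemma three_term_cos {R : realType} (t : R) :
  three_term (2 * cos t) (fun k => cos (k%:R * t)).
Proof.
move=> k /=.
have -> : k%:R * t = k.+1%:R * t - t by rewrite -natr1; ring.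
have -> : k.+2%:R * t = k.+1%:R * t + t by rewrite -[k.+2%:R]natr1; ring.
by rewrite cosB cosD; ring.
Qed.

Lemma three_term_sin {R : realType} (t : R) :
  three_term (2 * cos t) (fun k => sin (k%:R * t)).
Proof.
move=> k /=.
have -> : k%:R * t = k.+1%:R * t - t by rewrite -natr1; ring.
have -> : k.+2%:R * t = k.+1%:R * t + t by rewrite -[k.+2%:R]natr1; ring.
by rewrite sinB sinD; ring.
Qed.

(** In the variable [m], the coefficients [2 cos (m t)] satisfy the recurrence of [w]
itself, which gives the induction step from [m] and [m.+1] to [m.+2]. *)
Lemma three_term_dilate {R : realType} {t : R} {w : nat -> R} :
  three_term (2 * cos t) w -> forall m k,
  w k + w (k + m + m)%N = 2 * cos (m%:R * t) * w (k + m)%N.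
Proof.
move=> hw m.
suff [] : (forall k, w k + w (k + m + m)%N = 2 * cos (m%:R * t) * w (k + m)%N)
  /\ (forall k, w k + w (k + m.+1 + m.+1)%N =
        2 * cos (m.+1%:R * t) * w (k + m.+1)%N) by [].
elim: m => [|m [IH0 IH1]]; split=> // k.
- by rewrite mul0r cos0 !addn0; ring.
- by rewrite mul1r addn1 !addnS addn0 hw.
have e0 := IH0 k.+2; have e1 := IH1 k.+1.
have ekm := hw (k + m + m).+2; have ec := three_term_cos t m.
rewrite /= in ec; rewrite !(addSn, addnS) in e0 e1 *.
set W := w (k + m).+2 in e0 e1 *; set W0 := w k; set W4 := w _.
transitivity (W0 + w k.+2 + (w (k + m + m).+2 + W4)
  - (w k.+2 + w (k + m + m).+2)); first by ring.
rewrite ekm hw e0 -mulrDr e1.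
transitivity (2 * (2 * cos t * cos (m.+1%:R * t)) * W
  - 2 * cos (m%:R * t) * W); first by ring.
by rewrite -ec; ring.
Qed.

(** At an index where [|w|] is maximal, the two neighbours are at most as large. *)
Lemma three_term_bound {R : realType} {n : nat} {a c : R} {w : nat -> R} {k0} :
  (0 < n)%N -> `|c| = 1 -> three_term a w -> quasiperiodic n c w ->
  w k0 != 0 -> `|a| <= 2.
Proof.
move=> n0 c1 hw hq wk0.
have nw k : `|w k| = `|w (k %% n)%N|.
  by rewrite (quasiperiodic_modn hq k) normrM normrX c1 expr1n mul1r.
have [i _ imax] := @arg_maxP _ _ 'I_n (Ordinal n0) xpredT
  (fun i : 'I_n => `|w i|) isT.
have wmax k : `|w k| <= `|w i|.
  by rewrite nw; apply: (imax (Ordinal (ltn_pmod k n0))).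
have wi : 0 < `|w i| by apply: lt_le_trans (wmax k0); rewrite normr_gt0.
have [K eK] : exists K, `|w i| = `|w K.+1|.
  (* The maximum may sit at index 0, which has no left neighbour; one period
     further it always has one. *)
  exists (i + n).-1; rewrite prednK ?addn_gt0 ?n0 ?orbT //.
  by rewrite hq normrM c1 mul1r.
rewrite -(ler_pM2r wi) {1}eK -normrM -hw.
apply: (le_trans (ler_normD _ _)).
by have := wmax K; have := wmax K.+2; lra.
Qed.

(** Only nonnegative arguments are treated, so that the multiple of [2 pi] can be a
natural number. *)
Lemma cos_eq_sign {R : realType} {s : bool} {x : R} :
  0 <= x -> cos x = (-1) ^+ s -> exists j : nat, x = (2 * j%:R + s%:R) * pi.
Proof.
have pi0 := pi_gt0 R.
have key (y : R) : 0 <= y -> cos y = 1 -> exists j : nat, y = j%:R * (2 * pi).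
  move=> y0 cy; have q0 : 0 <= y / (2 * pi) by apply: divr_ge0 => //; lra.
  have /andP[] := truncn_itv q0; set j := Num.truncn _ => lo hi.
  rewrite ler_pdivlMr in lo; last by lra.
  rewrite ltr_pdivrMr in hi; last by lra.
  rewrite -natr1 in hi.
  exists j; apply/eqP; rewrite -subr_eq0; apply/eqP.
  set r := _ - _.
  have r0 : 0 <= r by rewrite /r; lra.
  have r2 : r < 2 * pi by rewrite /r; lra.
  have cr : cos r = 1.
    rewrite -cy -(periodicn (@cosD2pi R) j); congr cos.
    by rewrite /r -mulr_natl -[pi *+ 2]mulr_natl; ring.
  have [rp|rp] := leP r pi.
    by apply: cos_inj; rewrite ?in_itv /= ?cos0 ?cr //; lra.
  exfalso; have : 2 * pi - r = 0.
    apply: cos_inj; rewrite ?in_itv /= ?cos0; try lra.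
    have -> : 2 * pi - r = - r + pi *+ 2 by rewrite -mulr_natr; ring.
    by rewrite cosD2pi cosN.
  by lra.
case: s => x0 /= cx; last first.
  by have [j ->] := key x x0 cx; exists j; ring.
have [||[|j] ej] := key (x + pi); first by lra.
- by rewrite cosDpi cx expr1 opprK.
- by exfalso; lra.
by exists j; rewrite -natr1 in ej; lra.
Qed.

(** The bound on [a] lets it be written [2 cos t]; dilating the recurrence by a whole
period then yields [cos (n t) = (-1)^s]. *)
Lemma three_term_spectrum {R : realType} {n : nat} {s : bool} {a : R}
    {w : nat -> R} {k0 : nat} :
  (0 < n)%N -> three_term a w -> quasiperiodic n ((-1) ^+ s) w ->
  w k0 != 0 ->
  exists2 j : nat, (j <= n./2)%N & a = 2 * cos ((2 * j%:R + s%:R) * pi / n%:R).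
Proof.
move=> n0 hw hq wk0.
have pi0 := pi_gt0 R.
have nR : 0 < n%:R :> R by rewrite ltr0n.
have /ler_normlP[a1 a2] : `|a| <= 2.
  apply: (three_term_bound n0 _ hw hq wk0).
  by rewrite normrX normrN1 expr1n.
have a2i : a / 2 \in `[(-1), 1] by rewrite in_itv /=; lra.
have := a2i; rewrite in_itv /= => a2i'.
pose t : R := acos (a / 2).
have at2 : a = 2 * cos t by rewrite /t acosK //; lra.
have t0 : 0 <= t by apply: acos_ge0.
have tpi : t <= pi by apply: acos_lepi.
rewrite at2 in hw.
have cn : cos (n%:R * t) = (-1) ^+ s.
  have := three_term_dilate hw n k0; rewrite !hq.
  have ee : (-1) ^+ s * (-1) ^+ s = 1 :> R by rewrite -expr2 sqrr_sign.
  set e := (-1) ^+ s in ee *; rewrite mulrA ee mul1r => h.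
  apply: (mulIf wk0); suff : w k0 = cos (n%:R * t) * e * w k0.
    by move=> {2}->; rewrite -[LHS]mul1r -ee; ring.
  by lra.
have nt0 : 0 <= n%:R * t by apply: mulr_ge0 => //; lra.
have [j ej] := cos_eq_sign nt0 cn.
have et : t = (2 * j%:R + s%:R) * pi / n%:R.
  by rewrite -ej [n%:R * t]mulrC mulfK // gt_eqF.
exists j; last by rewrite at2 et.
have : (2 * j%:R + s%:R) * pi <= n%:R * pi :> R by rewrite -ej ler_pM2l.
rewrite ler_pM2r // -natrM -natrD ler_nat => le.
by rewrite -[j]doubleK half_leq // -mul2n; lia.
Qed.

(** Since [sin t <> 0], the coefficient of the sine can be chosen to match [w_1]. *)
Lemma three_term_trig {R : realType} {t : R} {w : nat -> R} :
  three_term (2 * cos t) w -> sin t != 0 ->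
  exists d : R, forall k, w k = w 0%N * cos (k%:R * t) + d * sin (k%:R * t).
Proof.
move=> hw st; exists ((w 1%N - w 0%N * cos t) / sin t).
set d := _ / _.
have hu := three_term_comb (w 0%N) d (three_term_cos t) (three_term_sin t).
have h := three_term_comb 1 (-1) hw hu.
move=> k; apply/eqP; rewrite -subr_eq0; apply/eqP.
have -> : w k - (w 0%N * cos (k%:R * t) + d * sin (k%:R * t)) =
  1 * w k + -1 * (w 0%N * cos (k%:R * t) + d * sin (k%:R * t)) by ring.
apply: (three_term_eq0 h); first by rewrite mul0r cos0 sin0; ring.
by rewrite !mul1r /d divfK //; ring.
Qed.

(** Here [cos t] is 1 or -1, a double root of the characteristic equation of the
recurrence, so the second solution is [k (cos t)^k] up to a scalar; the exponent
[k.+1] normalises it to 1 at [k = 1], because [(cos t)^2 = 1]. *)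
Lemma three_term_degenerate {R : realType} {t : R} {w : nat -> R} :
  three_term (2 * cos t) w -> sin t = 0 -> w 0%N = 0 ->
  forall k, w k = k%:R * cos t ^+ k.+1 * w 1%N.
Proof.
move=> hw st w0.
have c2 : cos t ^+ 2 = 1 by rewrite cos2sin2 st expr0n subr0.
move=> k; suff [] : w k = k%:R * cos t ^+ k.+1 * w 1%N /\
  w k.+1 = k.+1%:R * cos t ^+ k.+2 * w 1%N by [].
elim: k => [|k [IH0 IH1]]; split=> //; first by rewrite w0; ring.
  by rewrite c2; ring.
have -> : w k.+2 = 2 * cos t * w k.+1 - w k by rewrite -hw; ring.
rewrite IH0 IH1 -[k.+2%:R]natr1 -[k.+1%:R]natr1.
rewrite [cos t ^+ k.+3]exprS [cos t ^+ k.+2]exprS.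
apply/eqP; rewrite -subr_eq0; set e := cos t ^+ k.+1.
rewrite (_ : _ - _ = (cos t ^+ 2 - 1) * (k%:R * e * w 1%N)); last by ring.
by rewrite c2 subrr mul0r.
Qed.

(** Subtracting [w_0 cos (k t)] leaves a solution vanishing at 0, hence at [n] by the
twist; as it grows linearly, it vanishes identically. *)
Lemma three_term_degenerate_line {R : realType} {n : nat} {t c : R}
    {w : nat -> R} :
  (0 < n)%N ->
  three_term (2 * cos t) w -> sin t = 0 -> quasiperiodic n c w ->
  quasiperiodic n c (fun k => cos (k%:R * t)) ->
  forall k, w k = w 0%N * cos (k%:R * t).
Proof.
move=> n0 hw st hq hc k; apply/eqP; rewrite -subr_eq0; apply/eqP.
pose u k := 1 * w k + - w 0%N * cos (k%:R * t).
have hu : three_term (2 * cos t) u.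
  by apply: three_term_comb => //; exact: three_term_cos.
have qu : quasiperiodic n c u by apply: quasiperiodic_comb.
have u0 : u 0%N = 0 by rewrite /u mul0r cos0; ring.
have un : u n = 0 by rewrite -[n]add0n qu u0 mulr0.
have -> : w k - w 0%N * cos (k%:R * t) = u k by rewrite /u; ring.
have cz : cos t != 0.
  apply/eqP => c0; have := cos2Dsin2 t.
  by rewrite c0 st expr0n addr0 => /esym/eqP; rewrite oner_eq0.
apply: (three_term_eq0 hu u0); apply/eqP.
move: un; rewrite (three_term_degenerate hu st u0) => /eqP.
rewrite !mulf_eq0 pnatr_eq0 expf_eq0 (negPf cz) andbF orbF.
by rewrite -[n == _]negbK -lt0n n0.
Qed.

(** * Removing the signs by a change of gauge *)

(** Sequences are indexed by the vertices 1..n, so the coordinate [k : 'I_n] reads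
[w] at [k.+1], and index 0 is the copy of vertex [n] preceding vertex 1. *)
Definition gauge {R : realType} {n : nat} (beta : 'I_n -> bool)
    (w : nat -> R) : 'cV[R]_n :=
  \col_k (sign_upto R beta k * w k.+1).

Lemma edge_sign_sqr {R : realType} {n : nat} (beta : 'I_n -> bool)
    (i : 'I_n) :
  edge_sign R beta i * edge_sign R beta i = 1.
Proof. by rewrite -expr2 sqrr_sign. Qed.

Lemma sign_upto_sqr {R : realType} {n : nat} (beta : 'I_n -> bool)
    (i : 'I_n) :
  sign_upto R beta i * sign_upto R beta i = 1.
Proof.
rewrite -big_split big1 //= => k _; exact: edge_sign_sqr.
Qed.

Lemma sign_upto_first {R : realType} {n : nat} (beta : 'I_n -> bool)
    (i : 'I_n) :
  i = 0%N :> nat -> sign_upto R beta i = edge_sign R beta i.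
Proof.
move=> i0; rewrite /sign_upto (big_pred1 i) // => k /=.
by rewrite i0 leqn0 -val_eqE /= i0.
Qed.

Lemma sign_upto_next {R : realType} {n : nat} (beta : 'I_n -> bool)
    (i j : 'I_n) :
  j = i.+1 :> nat ->
  sign_upto R beta j = edge_sign R beta j * sign_upto R beta i.
Proof.
move=> ji; rewrite /sign_upto (bigD1 j) //=; congr (_ * _).
by apply: eq_bigl => k; rewrite -val_eqE /= ji; lia.
Qed.

Lemma sign_upto_last {R : realType} {n : nat} (beta : 'I_n -> bool)
    (i : 'I_n) :
  i.+1 = n -> sign_upto R beta i = cycle_sign R beta.
Proof.
by move=> iE; apply: eq_bigl => k; rewrite -ltnS iE ltn_ord.
Qed.

Lemma cycle_mxE {R : realType} {n : nat} (i j : 'I_n) :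
  cycle_mx R n i j = (j == ordS i)%:R.
Proof.
rewrite mxE -val_eqE /=; congr (nat_of_bool _)%:R.
have jn := ltn_ord j; have [e|ne] := eqVneq i.+1 n; last first.
  by rewrite orbF modn_small // ltn_neqAle ne ltn_ord.
by rewrite e modnn; apply: orb_idl => /eqP; lia.
Qed.

Lemma adj_mx_mul {R : realType} {n : nat} (beta : 'I_n -> bool) (v : 'cV[R]_n)
    (i : 'I_n) :
  (adj_mx R beta *m v) i ord0 =
  edge_sign R beta (ordS i) * v (ordS i) ord0
    + edge_sign R beta i * v (ord_pred i) ord0.
Proof.
rewrite mulmxDl mxE; congr (_ + _).
  rewrite mxE (bigD1 (ordS i)) //= big1 ?addr0.
    by rewrite mxE cycle_mxE eqxx mulr1.
  by move=> j /negPf ne; rewrite mxE cycle_mxE ne mulr0 mul0r.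
rewrite mxE (bigD1 (ord_pred i)) //= big1 ?addr0.
  by rewrite 2!mxE cycle_mxE ord_predK eqxx mulr1.
move=> j ne; rewrite 2!mxE cycle_mxE.
rewrite -(can2_eq (@ord_predK n) (@ordSK n)) eq_sym.
by rewrite (negPf ne) mulr0 mul0r.
Qed.

Lemma cycle_sign_sqr {R : realType} {n : nat} (beta : 'I_n -> bool) :
  cycle_sign R beta * cycle_sign R beta = 1.
Proof. rewrite -big_split big1 //= => k _; exact: edge_sign_sqr. Qed.

(** The signs met along the path cancel; crossing the edge from vertex [n] to vertex 1
leaves the factor [cycle_sign], which the twist of [w] absorbs. *)
Lemma adj_gauge {R : realType} {n : nat} (beta : 'I_n -> bool) (w : nat -> R)
    (i : 'I_n) :
  quasiperiodic n (cycle_sign R beta) w ->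
  (adj_mx R beta *m gauge beta w) i ord0 =
  sign_upto R beta i * (w i + w i.+2).
Proof.
move=> hq; rewrite adj_mx_mul !mxE mulrDr addrC; have ltin := ltn_ord i.
congr (_ + _).
  have [i0|i0] := posnP i.
    have ep : (ord_pred i).+1 = n by rewrite /= i0 add0n modn_small; lia.
    rewrite (sign_upto_last _ _ ep) ep (sign_upto_first _ _ i0).
    have -> : w n = cycle_sign R beta * w 0%N by rewrite -hq add0n.
    by rewrite i0 [cycle_sign R beta * _]mulrA cycle_sign_sqr mul1r.
  have ep : i = (ord_pred i).+1 :> nat.
    rewrite /= -{2}(prednK i0) addSn /= modnDr modn_small ?prednK //.
    by lia.
  by rewrite (sign_upto_next _ _ _ ep) -ep mulrA.
have [e|ne] := eqVneq i.+1 n.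
  have eS : ordS i = 0%N :> nat by rewrite /= e modnn.
  rewrite (sign_upto_last _ _ e) (sign_upto_first _ _ eS) eS.
  have -> : i.+2 = (1 + n)%N by lia.
  by rewrite hq !mulrA cycle_sign_sqr edge_sign_sqr.
have eS : ordS i = i.+1 :> nat.
  by rewrite /= modn_small // ltn_neqAle ne ltn_ord.
by rewrite (sign_upto_next _ _ _ eS) eS !mulrA edge_sign_sqr mul1r.
Qed.

Lemma gauge_comb {R : realType} {n : nat} (beta : 'I_n -> bool) (c d : R)
    (u w : nat -> R) :
  gauge beta (fun k => c * u k + d * w k) =
  c *: gauge beta u + d *: gauge beta w.
Proof. by apply/matrixP => k l; rewrite !mxE; ring. Qed.

Lemma gauge_coefK {R : realType} {n : nat} (beta : 'I_n -> bool) (w : nat -> R)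
    (i : 'I_n) :
  sign_upto R beta i * gauge beta w i ord0 = w i.+1.
Proof. by rewrite mxE mulrA sign_upto_sqr mul1r. Qed.

(** The hypothesis covers one period, the indices 1..n; index 0 is recovered from
index [n] by dividing by [c]. *)
Lemma quasiperiodic_eq0 {R : realType} {n : nat} {c : R} {w : nat -> R} :
  (0 < n)%N -> c != 0 -> quasiperiodic n c w ->
  (forall k, (k < n)%N -> w k.+1 = 0) -> forall k, w k = 0.
Proof.
move=> n0 c0 hq w0.
have wS k : w k.+1 = 0.
  have qS : quasiperiodic n c (fun k => w k.+1) by move=> l; rewrite -addSn hq.
  by rewrite (quasiperiodic_modn qS) w0 ?mulr0 // ltn_pmod.
case=> // ; apply/eqP; have := hq 0%N; rewrite add0n -(prednK n0) wS.
by move/esym/eqP; rewrite mulf_eq0 (negPf c0).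
Qed.

Lemma gauge_eq0 {R : realType} {n : nat} {beta : 'I_n -> bool} {w : nat -> R} :
  (0 < n)%N -> quasiperiodic n (cycle_sign R beta) w ->
  gauge beta w = 0 -> forall k, w k = 0.
Proof.
move=> n0 hq g0; apply: (quasiperiodic_eq0 n0 _ hq) => [|k kn].
  by rewrite prodf_seq_neq0; apply/allP => i _; apply/implyP; rewrite signr_eq0.
by have := gauge_coefK beta w (Ordinal kn); rewrite g0 mxE mulr0.
Qed.

(** The matrix equation only gives the recurrence for the indices below [n]; the twist
carries it to all indices. *)
Lemma gauge_eigen {R : realType} {n : nat} {beta : 'I_n -> bool} {w : nat -> R}
    (a : R) :
  (0 < n)%N -> quasiperiodic n (cycle_sign R beta) w ->
  adj_mx R beta *m gauge beta w = a *: gauge beta w <-> three_term a w.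
Proof.
move=> n0 hq; split=> [/matrixP eA|hw]; last first.
  apply/matrixP => i l; rewrite (ord1 l) adj_gauge // hw !mxE; ring.
pose u k := w k + w k.+2 - a * w k.+1.
have hu k : (k < n)%N -> u k = 0.
  move=> kn; have := eA (Ordinal kn) ord0; rewrite adj_gauge // !mxE /=.
  move=> /(congr1 ( *%R (sign_upto R beta (Ordinal kn)))).
  rewrite [a * _]mulrCA !mulrA sign_upto_sqr !mul1r /u => ->.
  by rewrite subrr.
have qu : quasiperiodic n (cycle_sign R beta) u.
  by move=> k; rewrite /u -!addSn !hq; ring.
move=> k; apply/eqP; rewrite -subr_eq0 -/(u k) (quasiperiodic_modn qu).
by rewrite hu ?mulr0 // ltn_pmod.
Qed.

Lemma gauge_surj {R : realType} {n : nat} (beta : 'I_n -> bool) (v : 'cV[R]_n) :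
  (0 < n)%N ->
  exists2 w, quasiperiodic n (cycle_sign R beta) w & v = gauge beta w.
Proof.
move=> n0; pose c := cycle_sign R beta.
pose i k := Ordinal (ltn_pmod k n0).
(* The shift by [n.-1] makes the residue of [k.+1] equal to [k]; the block of
   vertices 1..n then has quotient 1, and the leading [c] cancels its factor. *)
pose w k := c * c ^+ ((k + n.-1) %/ n) *
  (sign_upto R beta (i (k + n.-1)%N) * v (i (k + n.-1)%N) ord0).
exists w => [k|].
  rewrite /w addnAC divnDr // divnn n0 addn1 exprS.
  have -> : i (k + n.-1 + n)%N = i (k + n.-1)%N.
    by apply: val_inj; rewrite /= modnDr.
  by rewrite !mulrA.
apply/matrixP => k l; rewrite (ord1 l) mxE /w addSn -addnS prednK //.
have -> : i (k + n)%N = k.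
  by apply: val_inj; rewrite /= modnDr modn_small.
rewrite divnDr // divnn n0 divn_small // expr1 cycle_sign_sqr mul1r mulrA.
by rewrite sign_upto_sqr mul1r.
Qed.

(** * The trigonometric modes *)

Definition mode_angle (R : realType) (n : nat) (s : bool) (j : nat) : R :=
  (2 * j%:R + s%:R) * pi / n%:R.

Lemma shift_mode_angle {R : realType} {n : nat} (s : bool) (j k : nat) :
  (0 < n)%N ->
  (k + n)%:R * mode_angle R n s j =
  k%:R * mode_angle R n s j + pi *+ (2 * j + s).
Proof.
move=> n0; have nz : n%:R != 0 :> R by rewrite pnatr_eq0 -lt0n.
by rewrite natrD mulrDl -[pi *+ _]mulr_natr natrD natrM /mode_angle; field.
Qed.

Lemma mode_sign {R : realType} (s : bool) (j : nat) :
  (-1) ^+ (2 * j + s) = (-1) ^+ s :> R.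
Proof. by rewrite exprD exprM sqrrN expr1n expr1n mul1r. Qed.

Lemma mode_cos_quasiperiodic {R : realType} {n : nat} (s : bool) (j : nat) :
  (0 < n)%N ->
  quasiperiodic n ((-1) ^+ s) (fun k => cos (k%:R * mode_angle R n s j)).
Proof.
move=> n0 k.
by rewrite shift_mode_angle // (alternatingn (@cosDpi R)) mode_sign.
Qed.

Lemma mode_sin_quasiperiodic {R : realType} {n : nat} (s : bool) (j : nat) :
  (0 < n)%N ->
  quasiperiodic n ((-1) ^+ s) (fun k => sin (k%:R * mode_angle R n s j)).
Proof.
move=> n0 k.
by rewrite shift_mode_angle // (alternatingn (@sinDpi R)) mode_sign.
Qed.

Lemma xvec_gauge {R : realType} {n : nat} (beta : 'I_n -> bool)
    (s : bool) (j : nat) :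
  xvec R beta s j%:Z = gauge beta (fun k => cos (k%:R * mode_angle R n s j)).
Proof.
apply/matrixP => k l; rewrite !mxE; congr (_ * cos _).
by rewrite /mode_angle -pmulrn; ring.
Qed.

Lemma yvec_gauge {R : realType} {n : nat} (beta : 'I_n -> bool)
    (s : bool) (j : nat) :
  yvec R beta s j%:Z = gauge beta (fun k => sin (k%:R * mode_angle R n s j)).
Proof.
apply/matrixP => k l; rewrite !mxE; congr (_ * sin _).
by rewrite /mode_angle -pmulrn; ring.
Qed.

Lemma mu_cos {R : realType} (n : nat) (s : bool) (j : nat) :
  mu R n s j%:Z = 2 * cos (mode_angle R n s j).
Proof. by rewrite /mu -pmulrn. Qed.

(** The angles belonging to [j] and [n - s - j] add up to [2 pi]. *)
Lemma mu_reflect {R : realType} (n : nat) (s : bool) (j : int) :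
  (0 < n)%N -> mu R n s j = mu R n s (n%:Z - (s : nat)%:Z - j).
Proof.
move=> n0; have nz : n%:R != 0 :> R by rewrite pnatr_eq0 -lt0n.
rewrite /mu !intrB -!pmulrn; congr (_ * _).
rewrite -[LHS]cosN -[LHS]cosD2pi -[pi *+ 2]mulr_natl; congr cos; field.
by rewrite nz.
Qed.

Lemma cycle_sign_count {R : realType} {n : nat} (beta : 'I_n -> bool) :
  cycle_sign R beta = (-1) ^+ neg_count beta.
Proof. by rewrite /neg_count expr_sum. Qed.

Lemma mode_angle_eq {R : realType} (n : nat) (s : bool) (j k : nat) :
  (0 < n)%N -> (2 * j + s = k * n)%N -> mode_angle R n s j = k%:R * pi.
Proof.
move=> n0 e; have nz : n%:R != 0 :> R by rewrite pnatr_eq0 -lt0n.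
by rewrite /mode_angle -natrM -natrD e natrM; field.
Qed.

(** The angle is nonnegative and below [2 pi], where the sine vanishes only at 0 and
[pi]; the
last two hypotheses exclude these. *)
Lemma sin_mode_angle {R : realType} (n : nat) (s : bool) (j : nat) :
  (1 < n)%N -> (j <= n./2)%N -> (0 < 2 * j + s)%N -> (2 * j + s)%N != n ->
  sin (mode_angle R n s j) != 0.
Proof.
move=> n1 jn p0 pn; have pi0 := pi_gt0 R.
have nR : 0 < n%:R :> R by rewrite ltr0n; lia.
rewrite /mode_angle -natrM -natrD; move: p0 pn.
have : (2 * j + s < 2 * n)%N by case: (s) => /=; lia.
set p := (2 * j + s)%N => p2 p0 pn.
have [lt|gt|/eqP] := ltngtP p n; last by rewrite (negPf pn).
  apply: lt0r_neq0; apply: sin_gt0_pi; apply/andP; split.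
    by rewrite divr_gt0 // mulr_gt0 // ltr0n.
  by rewrite ltr_pdivrMr // mulrC ltr_pM2l // ltr_nat.
have -> : p%:R * pi / n%:R = (p%:R * pi / n%:R - pi) + pi :> R by ring.
rewrite sinDpi oppr_eq0; apply: lt0r_neq0; apply: sin_gt0_pi; apply/andP; split.
  by rewrite subr_gt0 ltr_pdivlMr // mulrC ltr_pM2r // ltr_nat.
rewrite ltrBlDr ltr_pdivrMr //.
have : p%:R < 2 * n%:R :> R by rewrite -natrM ltr_nat.
by rewrite -(ltr_pM2r pi0); lra.
Qed.

(** * Eigenspaces and spectrum *)

Lemma trig_modes_free {R : realType} {n : nat} (beta : 'I_n -> bool)
    (t : R) :
  (0 < n)%N ->
  quasiperiodic n (cycle_sign R beta) (fun k => cos (k%:R * t)) ->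
  quasiperiodic n (cycle_sign R beta) (fun k => sin (k%:R * t)) ->
  sin t != 0 ->
  free [:: gauge beta (fun k => cos (k%:R * t));
           gauge beta (fun k => sin (k%:R * t))].
Proof.
move=> n0 qc qs st; rewrite free_cons seq1_free span_seq1.
apply/andP; split; last first.
  by apply/eqP => /(gauge_eq0 n0 qs)/(_ 1%N)/eqP; rewrite mul1r (negPf st).
apply/negP => /vlineP[d e].
have := gauge_comb beta 1 (- d)
  (fun k => cos (k%:R * t)) (fun k => sin (k%:R * t)).
rewrite e scale1r scaleNr subrr.
move=> /(gauge_eq0 n0 (quasiperiodic_comb _ _ qc qs))/(_ 0%N)/eqP.
by rewrite mul0r cos0 sin0 mulr0 addr0 mulr1 oner_eq0.
Qed.

Lemma degenerate_eigenvectors {R : realType} {n : nat} (beta : 'I_n -> bool)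
    (t : R) (v : 'cV[R]_n) :
  (0 < n)%N ->
  quasiperiodic n (cycle_sign R beta) (fun k => cos (k%:R * t)) ->
  sin t = 0 ->
  eigenvector (adj_mx R beta) (2 * cos t) v <->
  exists2 c : R, c != 0 & v = c *: gauge beta (fun k => cos (k%:R * t)).
Proof.
move=> n0 qc st; set x := gauge _ _.
have xA : adj_mx R beta *m x = (2 * cos t) *: x.
  by apply/gauge_eigen => //; exact: three_term_cos.
have x0 : x != 0.
  by apply/eqP => /(gauge_eq0 n0 qc)/(_ 0%N)/eqP; rewrite mul0r cos0 oner_eq0.
split=> [[v0 vA]|[c c0 ->]]; last first.
  split; first by rewrite scaler_eq0 negb_or c0.
  by rewrite -scalemxAr xA !scalerA mulrC.
have [w qw ev] := gauge_surj beta v n0; rewrite ev in v0 vA *.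
move/(gauge_eigen _ n0 qw): vA => hw.
have wE := three_term_degenerate_line n0 hw st qw qc.
have e : gauge beta w = w 0%N *: x.
  by apply/matrixP => k l; rewrite !mxE wE; ring.
exists (w 0%N) => //; apply: contraNneq v0 => w00.
by rewrite e w00 scale0r.
Qed.

Lemma regular_eigenspace {R : realType} {n : nat} (beta : 'I_n -> bool)
    (t : R) :
  (0 < n)%N ->
  quasiperiodic n (cycle_sign R beta) (fun k => cos (k%:R * t)) ->
  quasiperiodic n (cycle_sign R beta) (fun k => sin (k%:R * t)) ->
  sin t != 0 ->
  passmx.leigenspace (mx_fun (adj_mx R beta)) (2 * cos t) =
  <<[:: gauge beta (fun k => cos (k%:R * t));
        gauge beta (fun k => sin (k%:R * t))]>>%VS.
Proof.
move=> n0 qc qs st; apply/vspaceP => v.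
rewrite span_cons span_seq1; apply/leigenspace_mxP/memv_addP => [vA|].
  have [w qw ev] := gauge_surj beta v n0; rewrite ev in vA *.
  move/(gauge_eigen _ n0 qw): vA => hw.
  have [d wE] := three_term_trig hw st.
  exists (w 0%N *: gauge beta (fun k => cos (k%:R * t))).
    by rewrite memvZ // memv_line.
  exists (d *: gauge beta (fun k => sin (k%:R * t))).
    by rewrite memvZ // memv_line.
  by rewrite -gauge_comb; apply/matrixP => k l; rewrite !mxE wE.
move=> [_ /vlineP[c ->] [_ /vlineP[d ->] ->]].
rewrite -gauge_comb; apply/gauge_eigen => //; first exact: quasiperiodic_comb.
by apply: three_term_comb; [exact: three_term_cos | exact: three_term_sin].
Qed.

(** The converse inclusion is uniform in [j]: the cosine mode takes the value 1 at
index 0, so it is nonzero also for the angles where the sine mode vanishes. *)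
Lemma adj_spectrum {R : realType} {n : nat} (beta : 'I_n -> bool)
    (s : bool) (a : R) :
  (0 < n)%N -> cycle_sign R beta = (-1) ^+ s ->
  passmx.leigenvalue (mx_fun (adj_mx R beta)) a <->
  exists2 j : nat, (j <= n./2)%N & a = 2 * cos (mode_angle R n s j).
Proof.
move=> n0 hs; split=> [ev|[j jn ->]].
  have [v /leigenspace_mxP vA v0] : exists2 v,
      v \in passmx.leigenspace (mx_fun (adj_mx R beta)) a & v != 0.
    by exists (vpick (passmx.leigenspace (mx_fun (adj_mx R beta)) a));
      rewrite ?memv_pick ?vpick0.
  have [w qw evw] := gauge_surj beta v n0; rewrite evw in v0 vA.
  move/(gauge_eigen _ n0 qw): vA => hw; rewrite hs in qw.
  have [k wk] : exists k, w k != 0.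
    apply: contrapT => /forallNP nw; case/eqP: v0.
    apply/matrixP => i l; rewrite !mxE; have /negP/negPn/eqP -> := nw i.+1.
    by rewrite mulr0.
  exact: (three_term_spectrum n0 hw qw wk).
have qc := mode_cos_quasiperiodic (R := R) s j n0; rewrite -hs in qc.
apply/eqP => E0.
have : gauge beta (fun k => cos (k%:R * mode_angle R n s j)) \in
    passmx.leigenspace (mx_fun (adj_mx R beta)) (2 * cos (mode_angle R n s j)).
  by apply/leigenspace_mxP/gauge_eigen => //; exact: three_term_cos.
rewrite E0 memv0 => /eqP/(gauge_eq0 n0 qc)/(_ 0%N)/eqP.
by rewrite mul0r cos0 oner_eq0.
Qed.

Theorem theorem10 (R : realType) (n : nat) (beta : 'I_n -> bool) (s : bool)
    (hn : (3 <= n)%N) (hs : cycle_sign R beta = (-1) ^+ s) :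
  let r := neg_count beta in
  let sigma := cycle_sign R beta in
  let A := adj_mx R beta in
  let mu := mu R n s in
  let x := xvec R beta s in
  let y := yvec R beta s in
  sigma = (-1) ^+ r /\
  (forall a : R, passmx.leigenvalue (mx_fun A) a <->
     exists2 j : nat, (j <= n./2)%N & a = mu j%:Z) /\
  (forall j : int, mu j = mu (n%:Z - (s : nat)%:Z - j)) /\
  (forall j : nat, (j <= n./2)%N ->
     ~ (sigma = 1 /\ j = 0%N) ->
     ~ (sigma = 1 /\ n = (2 * j)%N) ->
     ~ (sigma = -1 /\ n = (2 * j + 1)%N) ->
     [/\ eigenvector A (mu j%:Z) (x j%:Z),
         eigenvector A (mu j%:Z) (y j%:Z),
         free [:: x j%:Z; y j%:Z] &
         passmx.leigenspace (mx_fun A) (mu j%:Z) = <<[:: x j%:Z; y j%:Z]>>%VS]) /\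
  (sigma = 1 ->
     [/\ ~~ odd r, s = false, mu 0 = 2,
         (forall k : 'I_n, x 0 k ord0 = sign_upto R beta k) &
         forall v : 'cV[R]_n, eigenvector A (mu 0) v <->
           exists2 c : R, c != 0 & v = c *: x 0]) /\
  (forall m : nat, sigma = 1 -> n = (2 * m)%N ->
     [/\ mu m%:Z = -2,
         (forall k : 'I_n,
            x m%:Z k ord0 = (-1) ^+ k.+1 * sign_upto R beta k) &
         forall v : 'cV[R]_n, eigenvector A (mu m%:Z) v <->
           exists2 c : R, c != 0 & v = c *: x m%:Z]) /\
  (forall m : nat, sigma = -1 -> n = (2 * m + 1)%N ->
     [/\ odd r, s = true, mu m%:Z = -2,
         (forall k : 'I_n,
            x m%:Z k ord0 = (-1) ^+ k.+1 * sign_upto R beta k) &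
         forall v : 'cV[R]_n, eigenvector A (mu m%:Z) v <->
           exists2 c : R, c != 0 & v = c *: x m%:Z]).
Proof.
move=> r sigma A mu0 x y.
have n0 : (0 < n)%N by apply: leq_trans hn.
have qc j := mode_cos_quasiperiodic (R := R) s j n0.
have qs j := mode_sin_quasiperiodic (R := R) s j n0.
rewrite -hs in qc qs.
have N11 : (-1 : R) <> 1 by lra.
have sigmaE : sigma = (-1) ^+ r by exact: cycle_sign_count.
have s0 : sigma = 1 -> s = false by rewrite /sigma hs; case: (s).
have s1 : sigma = -1 -> s = true.
  by rewrite /sigma hs; case: (s) => //; rewrite expr0 => /esym.
have line0 j : sin (mode_angle R n s j) = 0 -> forall v : 'cV[R]_n,
    eigenvector A (mu0 j%:Z) v <-> exists2 c : R, c != 0 & v = c *: x j%:Z.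
  move=> st v; rewrite /mu0 /x mu_cos xvec_gauge.
  exact: degenerate_eigenvectors.
(* The eigenvalue -2 is treated for both parities of [n] at once: the angle is
   [pi] when [2 m + s = n]. *)
have linepi m : (2 * m + s)%N = n -> [/\ mu0 m%:Z = -2,
    (forall k : 'I_n, x m%:Z k ord0 = (-1) ^+ k.+1 * sign_upto R beta k) &
    forall v : 'cV[R]_n, eigenvector A (mu0 m%:Z) v <->
      exists2 c : R, c != 0 & v = c *: x m%:Z].
  move=> e; have tE : mode_angle R n s m = pi.
    by rewrite (mode_angle_eq n s m 1 n0) ?mul1r // mul1n.
  split.
  - by rewrite /mu0 mu_cos tE cospi mulrN1.
  - move=> k; rewrite /x xvec_gauge mxE tE mulrC; congr (_ * _).
    by rewrite mulr_natl -[pi *+ _]add0r (alternatingn (@cosDpi R)) cos0 mulr1.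
  - by apply: line0; rewrite tE sinpi.
split; [exact: sigmaE | split; [| split; [| split; [| split; [| split]]]]].
- by move=> a; apply: adj_spectrum.
- by move=> j; exact: mu_reflect.
- move=> j jn ha hb hc.
  have st : sin (mode_angle R n s j) != 0.
    apply: sin_mode_angle => //; first by apply: leq_trans hn.
      rewrite lt0n; apply/eqP => e; apply: ha; split; last by lia.
      by rewrite /sigma hs; case: (s) e => //=; lia.
    apply/eqP => e; case es : s e => e; last first.
      by apply: hb; rewrite /sigma hs es; split=> //; lia.
    by apply: hc; rewrite /sigma hs es; split=> //; lia.
  have fxy := trig_modes_free beta _ n0 (qc j) (qs j) st.
  rewrite -xvec_gauge -yvec_gauge in fxy.
  have Exy := regular_eigenspace beta _ n0 (qc j) (qs j) st.
  rewrite -xvec_gauge -yvec_gauge -mu_cos in Exy.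
  have eig v : v \in [:: x j%:Z; y j%:Z] -> eigenvector A (mu0 j%:Z) v.
    move=> vin; split; first exact: free_not0 fxy vin.
    by apply/leigenspace_mxP; rewrite Exy memv_span.
  by split=> //; apply: eig; rewrite !inE eqxx ?orbT.
- move=> h; have sf := s0 h.
  have tE : mode_angle R n s 0 = 0.
    by rewrite (mode_angle_eq n s 0 0 n0) ?mul0r // sf.
  split=> //.
  + by apply/negP => o; move: sigmaE; rewrite h -signr_odd o => /esym.
  + by rewrite /mu0 (mu_cos n s 0) tE cos0 mulr1.
  + by move=> k; rewrite /x (xvec_gauge beta s 0) mxE tE mulr0 cos0 mulr1.
  + by apply: (line0 0%N); rewrite tE sin0.
- by move=> m h e; apply: linepi; rewrite (s0 h) addn0.
- move=> m h e; have st := s1 h.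
  have [] := linepi m; first by rewrite st.
  split=> //; case o : (odd r) => //; move: sigmaE.
  by rewrite h -signr_odd o => /N11.
Qed.
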